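(* For every integer $n\geq 3$, the number of spanning quasi-trees of the bouquet $\mathbb{F}'^{n}_n$ is the $n$-th Lucas number: $\kappa(\mathbb{F}'^{n}_n)=\ell_n$.
   Context: A bouquet is a ribbon graph (surface with boundary made of vertex discs and edge ribbons) with exactly one vertex. A quasi-tree is a ribbon graph with exactly one boundary component; $\kappa(G)$ is the number of $F\subseteq E(G)$ such that the spanning ribbon subgraph $(V(G),F)$ (delete edges outside $F$) is a quasi-tree. A bouquet with edges $1,\dots,n$ is given by a signed rotation: a cyclic sequence in which each label occurs twice, recording the order in which the edge ends meet the vertex boundary; occurrences may carry a minus sign (plus omitted), and edge $i$ is an orientable loop iff its two occurrences have the same sign, non-orientable otherwise. For $n\geq3$, $\mathbb{F}'^{n}_n$ has signed rotation consisting of $1,2,3,2,1$, followed by $i,i-1$ for $i=4,\dots,n$, followed by $-n$, i.e. $(1,2,3,2,1,4,3,5,4,\dots,n,n-1,-n)$ (for $n=3$: $(1,2,3,2,1,-3)$); only edge $n$ is non-orientable. Lucas numbers: $\ell_1=1,\ell_2=3$, $\ell_k=\ell_{k-1}+\ell_{k-2}$. *)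

(* Defs.v *)
From HB Require Import structures.
From mathcomp Require Import all_boot.
From mathcomp Require Import finmap zify.

Set Implicit Arguments.
Unset Strict Implicit.
Unset Printing Implicit Defensive.

(* A signed rotation, read cyclically: an edge end is (label, sign), where    *)
(* the sign is true for a minus and false for a (usually omitted) plus.       *)
Definition signed_rotation := seq (nat * bool).

Definition is_bouquet (s : signed_rotation) : bool :=
  all (fun e => count_mem e (unzip1 s) == 2) (unzip1 s).

Definition edges (s : signed_rotation) : {fset nat} :=
  [fset e | e in unzip1 s]%fset.

(* The spanning ribbon subgraph with edge set F: deleting an edge of a        *)
(* bouquet erases its two occurrences from the signed rotation.               *)
Definition spanning_sub (s : signed_rotation) (F : {fset nat}) :
    signed_rotation :=
  [seq x <- s | x.1 \in F].

(* Every edge end occupies an arc of the boundary circle of the vertex disc.  *)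
(* The two endpoints of the arc at position p of s are (p, false), where the  *)
(* arc starts, and (p, true), where it stops, in the direction of the         *)
(* rotation. The boundary of the surface is cut at these points.              *)
Definition corner (s : signed_rotation) := ('I_(size s) * bool)%type.

Definition label_at (s : signed_rotation) (p : 'I_(size s)) : nat :=
  (nth (0, false) s p).1.
Definition sign_at (s : signed_rotation) (p : 'I_(size s)) : bool :=
  (nth (0, false) s p).2.

(* The free part of the vertex boundary between consecutive edge ends; ordS   *)
(* is the cyclic successor.                                                   *)
Definition vertex_arc (s : signed_rotation) : rel (corner s) :=
  [rel x y | [&& x.2, ~~ y.2 & y.1 == ordS x.1]].

(* The two free sides of a ribbon: they join a start to a stop when the loop  *)
(* is orientable (equal signs), and start to start, stop to stop when it is   *)
(* not.                                                                       *)
Definition ribbon_side (s : signed_rotation) : rel (corner s) :=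
  [rel x y | [&& x.1 != y.1, label_at x.1 == label_at y.1 &
    (x.2 == y.2) == (sign_at x.1 != sign_at y.1)]].

Definition boundary_adj (s : signed_rotation) : rel (corner s) :=
  [rel x y | [|| vertex_arc x y, vertex_arc y x | ribbon_side x y]].

(* Without edges the surface is the vertex disc, whose boundary is one circle *)
(* carrying no corner.                                                        *)
Definition boundary_components (s : signed_rotation) : nat :=
  if nilp s then 1 else n_comp (@boundary_adj s) predT.

Definition quasi_tree (s : signed_rotation) : bool :=
  boundary_components s == 1.

Definition kappa (s : signed_rotation) : nat :=
  #|` [fset F in fpowerset (edges s) | quasi_tree (spanning_sub s F)]|%fset.

(* (1,2,3,2,1, 4,3, 5,4, ..., n,n-1, -n), meaningful for n >= 3. *)
Definition Fprime (n : nat) : signed_rotation :=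
  [seq (i, false) | i <- [:: 1; 2; 3; 2; 1]
                         ++ flatten [seq [:: i; i.-1] | i <- iota 4 (n - 3)]]
  ++ [:: (n, true)].

(* The value 2 at 0 is the one forced by l_1 = 1, l_2 = 3 and the recurrence. *)
Fixpoint lucas (k : nat) : nat :=
  match k with
  | 0 => 2
  | 1 => 1
  | (k0.+1 as k1).+1 => lucas k1 + lucas k0
  end.

Lemma Fprime_count n e : 3 <= n ->
  count_mem e (unzip1 (Fprime n)) = (0 < e <= n).*2.
Proof.
rewrite /Fprime /unzip1 map_cat -map_comp map_id_in; last by [].
elim: n => // n IHn; rewrite leq_eqVlt => /orP[/eqP<-|].
  by case: e {IHn} => [|[|[|[|e]]]].
rewrite ltnS => n3; have := IHn n3.
rewrite subSn // -(addn1 (n - 3)) iotaD map_cat flatten_cat.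
have ->: 4 + (n - 3) = n.+1 by lia.
by rewrite !count_cat /=; lia.
Qed.

Lemma Fprime_is_bouquet n : 3 <= n -> is_bouquet (Fprime n).
Proof.
move=> n3; apply/allP => e; rewrite -has_pred1 has_count Fprime_count //.
by case: (0 < e <= n).
Qed.

Lemma edges_Fprime n : 3 <= n ->
  edges (Fprime n) = [fset e | e in iota 1 n]%fset.
Proof.
move=> n3; apply/fsetP => e; rewrite !in_fset /= -has_pred1 has_count.
by rewrite Fprime_count // mem_iota add1n ltnS; case: (0 < e <= n).
Qed.

(* Main.v *)
(* A bouquet has one boundary component iff every two-colouring of its        *)
(* boundary is constant. Such a colouring is a colouring of the gaps of the   *)
(* rotation, and the change of colour across an edge end is the same at both  *)
(* ends of an edge; so colourings up to a constant are the vectors x over     *)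
(* GF(2), indexed by the edges, in the kernel of the interlacement matrix     *)
(* (diagonal entry 1 at a non-orientable loop). For a spanning subgraph this  *)
(* is the principal submatrix on F. The interlacement graph of Fprime n is    *)
(* the fork 1 - 3, 2 - 3, 3 - 4 - ... - n with a loop at n. Let a(n), b(n) be *)
(* the numbers of nonsingular principal submatrices with and without the      *)
(* loop. Eliminating n gives a(n) = a(n-1) + b(n-1), as pivoting on the loop  *)
(* moves it to n-1, and b(n) = b(n-1) + b(n-2), as without a loop n can only  *)
(* be cancelled together with n-1. Hence b(n) = l_(n-1) and a(n) = l_n.       *)

Require Import Defs.
From mathcomp Require Import all_boot.
From mathcomp Require Import finmap zify.

Set Implicit Arguments.
Unset Strict Implicit.
Unset Printing Implicit Defensive.

(** Counting quasi-trees becomes counting nonsingular matrices over GF(2). By [quasi_tree_parityP] a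
    bouquet has a single boundary circle exactly when its interlacement matrix has trivial kernel,
    and by [quasi_tree_spanning_subP] the subgraph on F corresponds to the principal submatrix on F.
    For [Fprime n] the interlacement graph is a fork with a loop at its tip ([Fprime_split],
    [quasi_tree_FprimeP]).

    Gaussian elimination at the tip ([fork_nonsingular_notin], [fork_nonsingular_loop],
    [fork_nonsingular_noloop]) reduces the question to a shorter fork, and [fork_nonsingularP]
    packages this as a boolean test. Summing over F gives two coupled recurrences. The initial
    counts are 1 and 3 for the unlooped forks on 2 and 3 vertices, and 4 for the looped fork on 3
    vertices, so both sequences are Lucas, the looped one being one index ahead
    ([subset_count_noloop], [subset_count_loop]). *)

(** * Boundary components and the kernel of the interlacement matrix *)

Lemma n_comp1P (T : finType) (e : rel T) (x0 : T) : connect_sym e ->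
  reflect (forall c : T -> bool, (forall x y, e x y -> c x = c y) ->
             forall x y, c x = c y)
          (n_comp e predT == 1).
Proof.
move=> e_sym; apply: (iffP eqP) => [one c c_inv x y|const].
  have /closed_connect cl : closed e c by move=> u v /c_inv.
  apply: (cl); rewrite -(root_connect e_sym).
  have /card_le1_eqP le1 : #|[predI roots e & predT]| <= 1 by rewrite -one.
  by apply/eqP/le1; rewrite !inE roots_root.
rewrite -(n_comp_connect e_sym x0); apply: eq_n_comp_r => y.
(* Being connected to [x0] is itself an invariant colouring; its constancy makes every point
   reachable from [x0]. The point [x0] also excludes the empty type, which has no component at
   all. *)
have /(const _)/(_ x0 y) : forall u v, e u v -> connect e x0 u = connect e x0 v.
  by move=> u v /connect1 uv; apply: (same_connect_r e_sym uv).
by rewrite connect0 !inE.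
Qed.

Lemma boundary_adj_sym s : symmetric (@boundary_adj s).
Proof.
move=> x y; rewrite /boundary_adj /ribbon_side /= orbCA; congr [|| _, _ | _].
by rewrite eq_sym [label_at _ == _]eq_sym [x.2 == _]eq_sym [sign_at _ == _]eq_sym.
Qed.

Definition label_parity (x : nat -> bool) (s : signed_rotation) : bool :=
  \big[addb/false]_(a <- s) x a.1.

(* The label of an edge not interlaced with a.1 occurs 0 or 2 times in v, so  *)
(* these are the rows of the interlacement matrix applied to x.               *)
Definition parity_kernel (s : signed_rotation) (x : nat -> bool) : Prop :=
  forall u a v b w, s = u ++ a :: v ++ b :: w -> a.1 = b.1 ->
    label_parity x v = (a.2 != b.2) && x a.1.

Lemma label_parity_bouquet s x : is_bouquet s -> label_parity x s = false.
Proof.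
move=> /allP bs; rewrite /label_parity -(big_map fst xpredT).
rewrite -big_undup_iterop_count big_seq big1 // => e.
rewrite mem_undup => /bs /= /eqP ->.
by rewrite /= addbb.
Qed.

Lemma label_parity_take (s : signed_rotation) x p : p < size s ->
  label_parity x (take p.+1 s)
  = label_parity x (take p s) (+) x (nth (0, false) s p).1.
Proof.
by move=> ps; rewrite (take_nth (0, false)) // /label_parity big_rcons.
Qed.

Lemma label_parity_cat x u v :
  label_parity x (u ++ v) = label_parity x u (+) label_parity x v.
Proof. exact: big_cat. Qed.

(** The parity of the segment strictly between two positions is the sum of two prefix parities. In
    this form the kernel equations speak of positions, as the boundary colourings do. *)
Lemma parity_kernelP s x :
  parity_kernel s x <->
  forall p q, p < q < size s ->
    (nth (0, false) s p).1 = (nth (0, false) s q).1 ->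
    label_parity x (take p.+1 s) (+) label_parity x (take q s)
    = ((nth (0, false) s p).2 != (nth (0, false) s q).2)
      && x (nth (0, false) s p).1.
Proof.
split=> [ker p q /andP[pq qs] lab|ker u a v b w s_eq lab].
  set v := take (q - p.+1) (drop p.+1 s).
  have tq : take q s = take p.+1 s ++ v by rewrite -takeD subnKC.
  rewrite tq label_parity_cat addKb.
  apply: (ker (take p s) _ v _ (drop q.+1 s)) => //.
  rewrite -(drop_nth (0, false)) // -cat_rcons -take_nth ?(ltn_trans pq) //.
  by rewrite catA -tq cat_take_drop.
have := ker (size u) (size u + (size v).+1); rewrite s_eq.
have nu : nth (0, false) (u ++ a :: v ++ b :: w) (size u) = a.
  by rewrite nth_cat ltnn subnn.
have nv : nth (0, false) (u ++ a :: v ++ b :: w) (size u + (size v).+1) = b.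
  rewrite nth_cat ltnNge leq_addr /= addKn /= nth_cat ltnn subnn //.
rewrite nu nv -(cat_rcons a) -[(size u).+1](size_rcons u a) take_size_cat //.
rewrite -addSnnS -[(size u).+1](size_rcons u a) -size_cat catA take_size_cat //.
rewrite label_parity_cat addKb => -> //.
by rewrite !size_cat !size_rcons /=; lia.
Qed.

(** Summing a kernel vector along the rotation gives a boundary colouring; conversely, the colour
    changes across the edge ends of a boundary colouring form a kernel vector. Constant colourings
    correspond to the zero vector. *)
Theorem quasi_tree_parityP s : is_bouquet s ->
  quasi_tree s <->
  forall x, parity_kernel s x -> forall a, a \in s -> x a.1 = false.
Proof.
move=> bs; rewrite /quasi_tree /boundary_components.
case: ifP => [/nilP-> //|/negP s_nil].
have s0 : 0 < size s by rewrite lt0n; apply/negP.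
have sym := sym_connect_sym (@boundary_adj_sym s).
pose o0 := Ordinal s0.
split=> [/(n_comp1P (o0, false) sym) const x /parity_kernelP ker|triv].
  pose G k := label_parity x (take k s).
  have GS (p : 'I_(size s)) : G p.+1 = G p (+) x (label_at p).
    by rewrite /G label_parity_take.
  (* The boolean [y.2] counts as 0 or 1: a start is coloured by the prefix before its edge end, a
     stop by the prefix that includes it. *)
  pose c (y : corner s) := G (y.1 + y.2).
  have arc y z : vertex_arc y z -> c y = c z.
    rewrite /vertex_arc /c /= => /and3P[-> /negbTE-> /eqP->] /=.
    rewrite addn0 addn1; have := ltn_ord y.1; rewrite leq_eqVlt.
    case/orP=> [/eqP ys|ys]; last by rewrite modn_small.
    (* The arc from the last edge end back to the first closes up because each label occurs twice,
       so the total parity vanishes. *)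
    rewrite ys modnn /G take_size take0 label_parity_bouquet //.
    by rewrite /label_parity big_nil.
  have rib (y z : corner s) : y.1 < z.1 -> ribbon_side y z -> c y = c z.
    move=> yz /and3P[_ /eqP lab sg]; have /= := ker y.1 z.1.
    rewrite yz ltn_ord => /(_ isT lab).
    rewrite -/(G _) -/(G _) GS /c.
    rewrite -/(sign_at y.1) -/(sign_at z.1) -/(label_at y.1).
    case: y z lab sg {yz} => y yb [z zb] /= lab; move: (GS y) (GS z).
    rewrite lab; case: yb zb => [] [] /=; rewrite ?addn0 ?addn1;
      move=> gy gz; rewrite ?gy ?gz;
      case: (sign_at y); case: (sign_at z) => //= _;
      by case: (G y); case: (G z); case: (x _).
  have inv y z : boundary_adj y z -> c y = c z.
    case/or3P=> [/arc //|/arc -> //|yz].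
    case: (ltngtP y.1 z.1) => [lt|gt|eq]; first exact: rib.
      apply/esym/rib => //; move: yz; rewrite /ribbon_side /= eq_sym.
      by rewrite [label_at _ == _]eq_sym [y.2 == _]eq_sym [sign_at _ == _]eq_sym.
    by move: yz; rewrite /ribbon_side /= (val_inj eq) eqxx.
  move=> a /(nthP (0, false)) [p ps <-].
  have := const c inv (Ordinal ps, true) (Ordinal ps, false).
  rewrite /c /= addn0 addn1 (GS (Ordinal ps)) /label_at /=.
  by case: (G p) (x _) => [] [].
apply/(n_comp1P (o0, false) sym) => c inv.
have arc p : c (p, true) = c (ordS p, false).
  by apply: inv; rewrite /boundary_adj /vertex_arc /= eqxx.
have rib p q b : p != q -> label_at p = label_at q ->
    c (p, b) = c (q, b (+) (sign_at p == sign_at q)).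
  move=> pq lab; apply: inv; rewrite /boundary_adj /ribbon_side /= pq lab eqxx /=.
  by apply/or3P/Or33; case: b; case: (sign_at p == sign_at q).
(* The colour change across an edge end. The two ribbon sides carry it to the other end of the same
   edge, so it descends to a function [x] of the label. *)
pose d p := c (p, false) (+) c (p, true).
have d_lab p q : label_at p = label_at q -> d p = d q.
  move=> lab; case: (eqVneq p q) => [-> //|pq].
  rewrite /d !(rib p q) //.
  by case: (_ == _) => //=; rewrite addbC.
pose x e := [exists p : 'I_(size s), (label_at p == e) && d p].
have xE p : x (label_at p) = d p.
  apply/existsP/idP => [[q /andP[/eqP /d_lab -> //]]|dp].
  by exists p; rewrite eqxx.
have GE k (ks : k < size s) :
    label_parity x (take k s) = c (o0, false) (+) c (Ordinal ks, false).
  elim: k ks => [|k IHk] ks.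
    rewrite take0 /label_parity big_nil (_ : Ordinal ks = o0) ?addbb //.
    exact: val_inj.
  have ks' := ltnW ks.
  rewrite label_parity_take // (IHk ks') -/(label_at (Ordinal ks')) xE /d arc.
  have -> : ordS (Ordinal ks') = Ordinal ks by apply: val_inj; rewrite /= modn_small.
  by rewrite addbA addbK.
have d0 p : d p = false.
  rewrite -xE; apply: (triv x) (mem_nth _ (ltn_ord p)).
  apply/parity_kernelP => {}p q /andP[pq qs] lab.
  have ps := ltn_trans pq qs.
  pose p' := Ordinal ps; pose q' := Ordinal qs.
  rewrite label_parity_take // !GE -/p' -/q'.
  rewrite -/(label_at p') xE -/(sign_at p') -/(sign_at q').
  have pq' : p' != q' by rewrite -val_eqE /= ltn_eqF.
  rewrite /d !(rib p' q') //.
  by case: (sign_at p' == sign_at q') => /=;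
     case: (c (o0, _)); case: (c (q', true)); case: (c (q', false)).
(* With no colour change across any edge end, the vertex arcs carry the colour of the first corner
   all the way round. *)
have cst k (ks : k < size s) : c (Ordinal ks, false) = c (o0, false).
  elim: k ks => [|k IHk] ks; first by congr (c (_, _)); apply: val_inj.
  have ks' := ltnW ks.
  have <- : ordS (Ordinal ks') = Ordinal ks by apply: val_inj; rewrite /= modn_small.
  rewrite -arc -(IHk ks').
  by have := d0 (Ordinal ks'); rewrite /d; case: (c _); case: (c _).
suff all0 y : c y = c (o0, false) by move=> y z; rewrite !all0.
case: y => [[k ks] b]; rewrite -(cst k ks); case: b => //.
by have := d0 (Ordinal ks); rewrite /d; case: (c _); case: (c _).
Qed.

(** * Spanning subgraphs and principal submatrices *)

Lemma filter_eq_cat_cons (T : Type) (P : pred T) s u a r :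
  filter P s = u ++ a :: r ->
  exists u' r',
    [/\ s = u' ++ a :: r', u = filter P u', r = filter P r' & P a].
Proof.
elim: s u => [|y s IHs] [|z u] //=; case: ifP => Py //.
- by case=> <- <-; exists [::], s.
- by move=> /(IHs [::]) [u' [r' [-> /= eu -> Pa]]]; exists (y :: u'), r'; rewrite /= Py.
- by case=> <- /IHs [u' [r' [-> -> -> Pa]]]; exists (y :: u'), r'; rewrite /= Py.
- by move=> /(IHs (z :: u)) [u' [r' [-> eu -> Pa]]]; exists (y :: u'), r'; rewrite /= Py.
Qed.

Lemma spanning_sub_is_bouquet s F : is_bouquet s -> is_bouquet (spanning_sub s F).
Proof.
move=> /allP bs; apply/allP => e /mapP[a]; rewrite mem_filter => /andP[aF a_s] ->.
rewrite count_map count_filter; have := bs a.1 (map_f _ a_s).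
rewrite count_map => /eqP <-; apply/eqP/eq_count => b /=.
by case: eqP => // ->; rewrite aF.
Qed.

Lemma label_parity_spanning_sub x s (F : {fset nat}) :
  (forall e, e \notin F -> x e = false) ->
  label_parity x (spanning_sub s F) = label_parity x s.
Proof.
move=> supp; rewrite /label_parity big_filter big_mkcond.
by apply: eq_bigr => a _; case: ifPn => // /supp.
Qed.

(** A vector supported on F gets no contribution from erased edge ends, so the kernel equations of
    the subgraph can be read off the full rotation, keeping only the rows in F. *)
Theorem quasi_tree_spanning_subP s (F : {fset nat}) : is_bouquet s ->
  quasi_tree (spanning_sub s F) <->
  forall x, (forall e, e \notin F -> x e = false) ->
    (forall u a v b w, s = u ++ a :: v ++ b :: w -> a.1 = b.1 -> a.1 \in F ->
       label_parity x v = (a.2 != b.2) && x a.1) ->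
    forall a, a \in s -> x a.1 = false.
Proof.
move=> bs; rewrite quasi_tree_parityP ?spanning_sub_is_bouquet //.
split=> triv x; last first.
  move=> ker a; rewrite mem_filter => /andP[aF a_s].
  (* The equations of the subgraph only see labels in F, so an arbitrary kernel vector may be cut
     down to F. *)
  pose x' e := (e \in F) && x e.
  have supp e : e \notin F -> x' e = false by rewrite /x' => /negbTE->.
  suff : x' a.1 = false by rewrite /x' aF.
  apply: (triv x') a_s => // u {}a v b w s_eq lab {}aF.
  rewrite -(label_parity_spanning_sub _ supp).
  have -> : label_parity x' (spanning_sub v F) = label_parity x (spanning_sub v F).
    by rewrite /label_parity !big_filter; apply: eq_bigr => y yF; rewrite /x' yF.
  rewrite /x' aF /=.
  apply: (ker (spanning_sub u F) _ _ b (spanning_sub w F)) => //.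
  by rewrite s_eq /spanning_sub filter_cat /= aF filter_cat /= -lab aF.
move=> supp ker a a_s; case: (boolP (a.1 \in F)) => [aF|/supp //].
apply: (triv x); last by rewrite mem_filter aF.
move=> u {aF a_s}a v b w f_eq lab.
have [u' [r' [s_eq _ r_eq aF]]] := filter_eq_cat_cons f_eq.
have [v' [w' [r'_eq -> _ _]]] := filter_eq_cat_cons (esym r_eq).
rewrite [label_parity _ _](label_parity_spanning_sub _ supp).
by apply: (ker u' _ _ _ w'); rewrite // s_eq r'_eq.
Qed.

(** * The interlacement graph of [Fprime n] is a looped fork *)

Lemma first_occurrence_unique (u u' r r' : signed_rotation) a a' :
  u ++ a :: r = u' ++ a' :: r' -> a.1 = a'.1 ->
  a.1 \notin unzip1 u -> a.1 \notin unzip1 u' ->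
  [/\ u = u', a = a' & r = r'].
Proof.
elim: u u' => [|y u IHu] [|y' u'] /=.
- by case.
- by case=> <- _ _ _; rewrite inE eqxx.
- by case=> -> _ ->; rewrite inE eqxx.
case=> <- eq lab; rewrite !inE !negb_or => /andP[_ au] /andP[_ au'].
by have [<- <- <-] := IHu _ eq lab au au'.
Qed.

(** Kernel equations quantify over all splittings at an edge; by uniqueness, one explicit splitting
    per edge suffices. *)
Lemma occurrences_unique (s u v w u' v' w' : signed_rotation)
    (a b a' b' : nat * bool) :
  count_mem a.1 (unzip1 s) = 2 ->
  s = u ++ a :: v ++ b :: w -> s = u' ++ a' :: v' ++ b' :: w' ->
  a.1 = b.1 -> a'.1 = b'.1 -> a.1 = a'.1 -> [/\ a = a', v = v' & b = b'].
Proof.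
move=> + s_eq s_eq' ab a'b' aa'.
have notin (p q r : signed_rotation) (c d : nat * bool) :
    s = p ++ c :: q ++ d :: r -> c.1 = a.1 -> d.1 = a.1 ->
    count_mem a.1 (unzip1 s) = 2 -> a.1 \notin unzip1 p /\ a.1 \notin unzip1 q.
  move=> -> ca da; rewrite /unzip1 !(map_cat, count_cat) /= map_cat count_cat /=.
  rewrite ca da eqxx -!has_pred1 !has_count -!leqNgt.
  by do 3!move: (count_mem _ _) => ?; lia.
move=> two; have [au av] := notin _ _ _ _ _ s_eq erefl (esym ab) two.
have [au' av'] := notin _ _ _ _ _ s_eq' (esym aa') (esym (etrans aa' a'b')) two.
have [_ a_eq r_eq] :=
  first_occurrence_unique (etrans (esym s_eq) s_eq') aa' au au'.
have bb' : b.1 = b'.1 by rewrite -ab aa'.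
rewrite ab in av av'.
by have [-> -> _] := first_occurrence_unique r_eq bb' av av'.
Qed.

Definition fork_prev (x : nat -> bool) (e : nat) : bool :=
  if e == 3 then x 1 (+) x 2 else x e.-1.

(** For positive e, the row of e in the adjacency matrix of the infinite fork with prongs 1 and 2 at
    3 and tail 3, 4, 5 and so on. The fork is truncated at n by applying this to vectors that vanish
    beyond n. *)
Definition fork_adj (x : nat -> bool) (e : nat) : bool :=
  if e <= 2 then x 3 else fork_prev x e (+) x e.+1.

Lemma fork_adjE x e : 3 <= e -> fork_adj x e = fork_prev x e (+) x e.+1.
Proof. by move=> e3; rewrite /fork_adj leqNgt e3. Qed.

Lemma fork_prevE x e : 4 <= e -> fork_prev x e = x e.-1.
Proof. by move=> e4; rewrite /fork_prev gtn_eqF. Qed.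

Lemma eq_fork_prev x y e : 3 <= e ->
  (forall i, 0 < i < e -> x i = y i) -> fork_prev x e = fork_prev y e.
Proof.
move=> e3 xy; rewrite /fork_prev; case: eqP => [e_eq|_].
  by rewrite !xy // e_eq.
by rewrite xy //; lia.
Qed.

Lemma eq_fork_adj x y e m : 3 <= m -> e < m ->
  (forall i, 0 < i <= m -> x i = y i) -> fork_adj x e = fork_adj y e.
Proof.
move=> m3 em xy; case: (leqP e 2) => e2; first by rewrite /fork_adj e2 xy.
rewrite !fork_adjE // xy // (@eq_fork_prev x y) // => i /andP[i0 ie].
by apply: xy; lia.
Qed.

(** The row of n reads the entry at [n.+1], which is why that entry is assumed to vanish. The term
    with [e == n] is the diagonal entry of the non-orientable loop. *)
Lemma Fprime_split n e : 3 <= n -> 0 < e <= n ->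
  exists u v b w, Fprime n = u ++ (e, false) :: v ++ (e, b) :: w /\
    forall x, x n.+1 = false ->
      label_parity x v (+) (b && x e) = fork_adj x e (+) ((e == n) && x e).
Proof.
move=> n3 /andP[e0 en].
have pE (x : nat -> bool) l :
    label_parity x [seq (i, false) | i <- l] = foldr (fun i => addb (x i)) false l.
  by elim: l => [|i l IHl]; rewrite /label_parity ?big_nil //= big_cons -IHl.
pose m l := [seq (i, false) | i <- l] : signed_rotation.
case: (ltngtP e 3) => [e3|e3|e3].
- have {e0 e3} [->|->] : e = 1 \/ e = 2 by lia.
    exists [::], (m [:: 2; 3; 2]), false; eexists; split; first by rewrite /Fprime.
    move=> x _; rewrite pE /fork_adj /fork_prev /= (_ : (1 == n) = false); last by lia.
    by case: (x 2); case: (x 3).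
  exists (m [:: 1]), (m [:: 3]), false; eexists; split; first by rewrite /Fprime.
  move=> x _; rewrite pE /fork_adj /fork_prev /= (_ : (2 == n) = false); last by lia.
  by case: (x 3).
- move: en; rewrite leq_eqVlt => /orP[/eqP en|en].
    (* The rotation ends in n, n-1, -n; the prefix stops after the block of n-1. *)
    exists (m ([:: 1; 2; 3; 2; 1] ++ flatten [seq [:: i; i.-1] | i <- iota 4 (n - 4)])).
    exists (m [:: n.-1]), true, [::]; split.
      rewrite /Fprime en (_ : n - 3 = n - 4 + 1); last by lia.
      rewrite iotaD !map_cat flatten_cat subnKC; last by lia.
      by rewrite /m !map_cat /= -!catA.
    move=> x xn; rewrite pE /fork_adj /fork_prev en eqxx xn /=.
    by rewrite !ifF ?addbF //; lia.
  (* The blocks e, e-1 and e+1, e are consecutive, so only e-1 and e+1 lie between the two ends of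
     e. *)
  exists (m ([:: 1; 2; 3; 2; 1] ++ flatten [seq [:: i; i.-1] | i <- iota 4 (e - 4)])).
  exists (m [:: e.-1; e.+1]), false; eexists; split.
    rewrite /Fprime (_ : n - 3 = e - 4 + (n - e.+1).+2); last by lia.
    rewrite iotaD !map_cat flatten_cat subnKC //.
    rewrite /m !map_cat -!catA /=; reflexivity.
  move=> x _; rewrite pE /fork_adj /fork_prev /= addbF.
  by rewrite !ifF ?(ltn_eqF en) ?addbF //; lia.
rewrite e3 {e3 en e0}; move: n3; rewrite leq_eqVlt => /orP[/eqP<-|n3].
  exists (m [:: 1; 2]), (m [:: 2; 1]), true, [::]; split=> // x x4.
  by rewrite pE /fork_adj /fork_prev /= x4; case: (x 1); case: (x 2); case: (x 3).
exists (m [:: 1; 2]), (m [:: 2; 1; 4]), false; eexists; split.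
  rewrite /Fprime (_ : n - 3 = (n - 4).+1); last by lia.
  by [].
move=> x _; rewrite pE /fork_adj /fork_prev /= (ltn_eqF n3).
by case: (x 1); case: (x 2); case: (x 4).
Qed.

(* The flag l tells whether the vertex n of the fork carries a loop.          *)
Definition fork_kernel n (l : bool) (F : {fset nat}) (x : nat -> bool) : Prop :=
  (forall e, 0 < e <= n -> e \in F ->
     fork_adj x e (+) [&& l, e == n & x e] = false) /\
  (forall e, ~~ [&& 0 < e, e <= n & e \in F] -> x e = false).

Definition fork_nonsingular n l F : Prop :=
  forall x, fork_kernel n l F x -> forall e, x e = false.

Lemma quasi_tree_FprimeP n F : 3 <= n ->
  quasi_tree (spanning_sub (Fprime n) F) <-> fork_nonsingular n true F.
Proof.
move=> n3; rewrite quasi_tree_spanning_subP ?Fprime_is_bouquet //.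
have mem_s e : (e \in unzip1 (Fprime n)) = (0 < e <= n).
  by rewrite -has_pred1 has_count Fprime_count //; case: (_ < _ <= _).
split=> [triv x [ker supp] e|triv x supp ker a a_s].
  case: (boolP [&& 0 < e, e <= n & e \in F]) => [|/supp //].
  case/and3P=> e0 en eF; have /mapP[a a_s ->] : e \in unzip1 (Fprime n).
    by rewrite mem_s e0.
  apply: (triv x) a_s => [i iF|u {}a v b w s_eq lab aF].
    by apply: supp; rewrite (negbTE iF) !andbF.
  have an : 0 < a.1 <= n.
    by rewrite -mem_s s_eq /unzip1 map_cat mem_cat inE eqxx orbT.
  have [u' [v' [b' [w' [s_eq' par]]]]] := Fprime_split n3 an.
  have two : count_mem a.1 (unzip1 (Fprime n)) = 2 by rewrite Fprime_count // an.
  have [-> -> ->] := occurrences_unique two s_eq s_eq' lab erefl erefl.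
  have := ker _ an aF; rewrite -par /=; last by apply: supp; rewrite ltnn andbF.
  by case: (label_parity _ _); case: b' {s_eq' par}; case: (x _).
(* F may contain labels that are not edges, where [x] is unconstrained; [y] discards them. *)
pose y e := [&& 0 < e, e <= n & x e].
have an : 0 < a.1 <= n by rewrite -mem_s map_f.
suff : y a.1 = false by rewrite /y andbA an.
apply: triv; split=> [e en eF|e]; last first.
  by rewrite /y; case: (boolP (e \in F)) => [_|/supp ->];
    rewrite ?andbF // andbT andbA => /negbTE->.
have [u [v [b [w [s_eq par]]]]] := Fprime_split n3 en.
rewrite /= -par; last by rewrite /y ltnn.
have -> : y e = x e by rewrite /y andbA en.
have -> : label_parity y v = label_parity x v.
  rewrite /label_parity !big_seq; apply: eq_bigr => c cv.
  suff cn : 0 < c.1 <= n by rewrite /y andbA cn.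
  by rewrite -mem_s map_f // s_eq mem_cat inE mem_cat cv !orbT.
by rewrite (ker _ _ _ _ _ s_eq) //=; case: b {s_eq par}; case: (x e).
Qed.

(** * Elimination at the tip of the fork *)

(** The prongs are adjacent only to 3, so on two vertices the matrix is zero, and only its empty
    principal submatrix is nonsingular. *)
Lemma fork_nonsingular2 F :
  fork_nonsingular 2 false F <-> (1 \notin F) && (2 \notin F).
Proof.
split=> [ns|/andP[F1 F2] x [_ supp] e]; last first.
  by apply: supp; case: e => [|[|[|e]]] //=; rewrite ?(negbTE F1) ?(negbTE F2).
have notin i : 0 < i <= 2 -> i \notin F.
  move=> i2; apply/negP => iF; suff : (i == i) = false by rewrite eqxx.
  apply: (ns (eq_op^~ i)); split=> [e /andP[_ e2] _|e].
    by rewrite /fork_adj e2 /= addbF; lia.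
  by apply: contraNF => /eqP->; rewrite andbA i2 iF.
by rewrite !notin.
Qed.

Lemma fork_nonsingular_notin n l F : n.+1 \notin F ->
  fork_nonsingular n.+1 l F <-> fork_nonsingular n false F.
Proof.
move=> nF; suff ker x : fork_kernel n.+1 l F x <-> fork_kernel n false F x.
  by split=> ns x /ker /ns.
have rng e : [&& 0 < e, e <= n.+1 & e \in F] = [&& 0 < e, e <= n & e \in F].
  rewrite (leq_eqVlt e n.+1) ltnS; case: eqP => //= ->.
  by rewrite (negbTE nF) !andbF.
split=> -[ker supp]; split=> e => [en eF|];
  try by [rewrite -rng; apply: supp | rewrite rng; apply: supp].
  rewrite -[RHS](ker e) //=; last by lia.
  by rewrite (_ : (e == n.+1) = false) ?andbF //; lia.
have en' : 0 < e <= n by have := rng e; rewrite eF !andbT en.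
rewrite -[RHS](ker e) //= (_ : (e == n.+1) = false) ?andbF //.
by lia.
Qed.

(** Pivot on the loop: the row of [n.+1] says [x n = x n.+1], and substituting this into the row of
    n creates a diagonal entry there. Since n is at least 3, the tip has n as its only other
    neighbour. *)
Lemma fork_nonsingular_loop n F : 3 <= n -> n.+1 \in F ->
  fork_nonsingular n.+1 true F <-> fork_nonsingular n true F.
Proof.
move=> n3 nF; split=> ns x [ker supp].
  (* The row of n.+1 forces the value of a kernel vector there. *)
  pose y e := if e == n.+1 then x n else x e.
  have xn : x n.+1 = false by apply: supp; rewrite ltnn andbF.
  have yx i : 0 < i <= n -> x i = y i by rewrite /y => ?; rewrite ifF //; lia.
  suff y0 e : y e = false by move=> e; have := y0 e; rewrite /y; case: eqP => // ->.
  apply: (ns y); split=> {}e => [en eF|]; last first.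
    rewrite /y; case: eqP => [->|ne]; first by rewrite nF leqnn.
    by move=> h; apply: supp; apply: contra h => /and3P[-> h ->]; rewrite leqW.
  case: (ltngtP e n) => [lt_en|gt_en|e_eq].
  - rewrite -(eq_fork_adj n3 lt_en yx) -[RHS](ker e) //; last by lia.
    by rewrite (ltn_eqF lt_en) (ltn_eqF (leqW lt_en)).
  - have -> : e = n.+1 by lia.
    rewrite fork_adjE ?fork_prevE ?ltnS ?(ltnW n3) //= eqxx /y eqxx.
    rewrite (ltn_eqF (ltnSn n)) (gtn_eqF (ltnSn n.+1)).
    by rewrite (supp n.+2) ?addbF ?addbb //; lia.
  have := ker e; rewrite e_eq leqnn andbT fork_adjE // xn addbF eqxx /=.
  rewrite -e_eq eF => /(_ (ltac:(lia)) isT); rewrite e_eq => h.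
  rewrite fork_adjE // -(@eq_fork_prev x) // => [|i ?]; last by apply: yx; lia.
  by rewrite (ltn_eqF (ltnSn n)) /= addbF /y eqxx.
pose y e := (e != n.+1) && x e.
have xn2 : x n.+2 = false by apply: supp; rewrite ltnn andbF.
have xn : x n = x n.+1.
  have := ker n.+1; rewrite leqnn nF eqxx => /(_ isT isT).
  rewrite fork_adjE ?fork_prevE ?ltnS ?(ltnW n3) //= xn2 addbF.
  by case: (x n); case: (x n.+1).
have yx i : 0 < i <= n -> x i = y i by rewrite /y => ?; rewrite (_ : _ != _) //; lia.
have y0 : forall e, y e = false.
  apply: ns; split=> e => [en eF|]; last first.
    rewrite /y; case: eqP => //= ne h; apply: supp; apply: contra h.
    by case/and3P=> -> h ->; rewrite andbT; lia.
  rewrite -[RHS](ker e) //; last by lia.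
  rewrite [e == n.+1](_ : _ = false) ?andbF ?addbF; last by lia.
  case: (ltngtP e n) => [lt_en|gt_en|->]; [|lia|].
    by rewrite -(eq_fork_adj n3 lt_en yx) addbF.
  rewrite !fork_adjE // (@eq_fork_prev y x) // => [|i ?]; last by rewrite yx //; lia.
  rewrite -(yx n) ?leqnn ?andbT; last by lia.
  by rewrite /y eqxx /= addbF xn.
move=> e; have := y0 e; rewrite /y; case: eqP => //= -> _.
by rewrite -xn yx ?y0 // leqnn; lia.
Qed.

(** The unlooped tip [n.+2] has [n.+1] as its sole neighbour. If that is missing, the tip is
    isolated and its row is zero. Otherwise the row of the tip kills the entry at [n.+1], the row of
    [n.+1] determines the entry at the tip, and what remains is the fork on n vertices. *)
Lemma fork_nonsingular_noloop n F : 2 <= n -> n.+2 \in F ->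
  fork_nonsingular n.+2 false F <->
  (n.+1 \in F) /\ fork_nonsingular n false F.
Proof.
move=> n2 nF; split=> [ns|[nF1 ns] x [ker supp]].
  split=> [|x [ker supp]].
    apply: contraT => nF1; suff : (n.+2 == n.+2) = false by rewrite eqxx.
    apply: (ns (eq_op^~ n.+2)); split=> e => [en eF|]; last first.
      by apply: contraNF => /eqP->; rewrite leqnn nF.
    rewrite addbF; case: (ltngtP e n.+1) => [lt_en|gt_en|e_eq].
    - by rewrite (@eq_fork_adj _ xpred0 e n.+1) ?ltnS // => [|i ?];
        [rewrite /fork_adj /fork_prev; case: ifP => //; case: ifP | lia].
    - have -> : e = n.+2 by lia.
      by rewrite fork_adjE ?fork_prevE ?ltnS ?(ltnW n2) //=; lia.
    by rewrite e_eq (negbTE nF1) in eF.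
  (* A kernel vector of the short fork is extended by solving the row of [n.+1] for the entry at the
     tip. *)
  pose y e := if e == n.+2 then (n.+1 \in F) && fork_prev x n.+1 else x e.
  have xn1 : x n.+1 = false by apply: supp; rewrite ltnn andbF.
  have xn2 : x n.+2 = false by apply: supp; lia.
  have yx i : 0 < i <= n.+1 -> x i = y i by rewrite /y => ?; rewrite ifF //; lia.
  suff y0 e : y e = false by move=> e; have := y0 e; rewrite /y; case: eqP => // ->.
  apply: (ns y); split=> {}e => [en eF|]; last first.
    rewrite /y; case: eqP => [->|ne]; first by rewrite nF leqnn.
    by move=> h; apply: supp; apply: contra h => /and3P[-> h ->]; rewrite !leqW.
  rewrite addbF; case: (ltngtP e n.+1) => [lt_en|gt_en|e_eq].
  - rewrite -(@eq_fork_adj x _ _ n.+1) //.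
    by rewrite -[RHS](ker e) ?addbF //; lia.
  - have -> : e = n.+2 by lia.
    rewrite fork_adjE ?fork_prevE ?ltnS ?(ltnW n2) //= -yx ?leqnn //.
    rewrite xn1 /y ifF; last by lia.
    by apply: supp; lia.
  rewrite e_eq fork_adjE // -(@eq_fork_prev x) // => [|i ?]; last by apply: yx; lia.
  by rewrite /y eqxx -[in _ \in F]e_eq eF addbb.
have xn3 : x n.+3 = false by apply: supp; rewrite ltnn andbF.
have xn1 : x n.+1 = false.
  have := ker n.+2; rewrite leqnn nF /= => /(_ isT isT).
  by rewrite fork_adjE ?fork_prevE ?ltnS ?(ltnW n2) //= xn3 !addbF.
pose y e := (e != n.+2) && x e.
have yx i : 0 < i <= n.+1 -> x i = y i by rewrite /y => ?; rewrite (_ : _ != _) //; lia.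
have y0 : forall e, y e = false.
  apply: ns; split=> e => [en eF|].
    rewrite -(@eq_fork_adj x _ _ n.+1) //; last by lia.
    by rewrite -[RHS](ker e) ?addbF //; lia.
  rewrite /y; case: eqP => //= ne h; case: (eqVneq e n.+1) => [->//|ne'].
  apply: supp; apply: contra h.
  by case/and3P=> -> h ->; rewrite andbT; lia.
move=> e; have := y0 e; rewrite /y; case: eqP => //= -> _.
have := ker n.+1; rewrite nF1 leqnSn => /(_ isT isT).
rewrite fork_adjE // addbF (@eq_fork_prev x y) // => [|i ?]; last by apply: yx; lia.
by rewrite /fork_prev !y0 /= if_same.
Qed.

(** Two prongs have equal rows, giving a kernel vector supported on 1 and 2. A single prong pairs
    off with 3, with or without a loop. With no prong, only the loop keeps the row of 3 from being
    zero. *)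
Lemma fork_nonsingular3 l F : 3 \in F ->
  fork_nonsingular 3 l F <->
  if l then ~~ ((1 \in F) && (2 \in F)) else (1 \in F) (+) (2 \in F).
Proof.
move=> F3; split=> [ns|].
  have F12 : ~~ ((1 \in F) && (2 \in F)).
    apply/negP => /andP[F1 F2]; suff : (1 == 1) || (1 == 2) = false by [].
    apply: (ns (fun e => (e == 1) || (e == 2))); split=> [|e].
      by case=> [|[|[|[|e]]]]; rewrite //= andbF.
    by apply: contraNF => /orP[] /eqP->; rewrite ?F1 ?F2.
  case: l ns => // ns.
  case: (boolP (1 \in F)) (boolP (2 \in F)) F12 => F1 [] F2 //= _.
  suff : (3 == 3) = false by [].
  apply: (ns (eq_op^~ 3)); split=> [|e].
    by case=> [|[|[|[|e]]]]; rewrite ?(negbTE F1) ?(negbTE F2).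
  by apply: contraNF => /eqP->.
move=> cnd x [ker supp].
have x4 : x 4 = false by apply: supp.
have x1 : x 1 ==> (1 \in F) by apply/implyP; apply: contraTT => h; rewrite supp // (negbTE h).
have x2 : x 2 ==> (2 \in F) by apply/implyP; apply: contraTT => h; rewrite supp // (negbTE h).
have k1 : (1 \in F) ==> ~~ x 3.
  by apply/implyP => /(ker 1 isT); rewrite /fork_adj /= andbF addbF => ->.
have k2 : (2 \in F) ==> ~~ x 3.
  by apply/implyP => /(ker 2 isT); rewrite /fork_adj /= andbF addbF => ->.
have all0 : [/\ x 1 = false, x 2 = false & x 3 = false].
  have := ker 3 isT F3; rewrite /fork_adj /fork_prev /= x4 addbF.
  case: l {ker} cnd => /=; move: x1 x2 k1 k2; case: (1 \in F); case: (2 \in F);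
    by case: (x 1); case: (x 2); case: (x 3).
case: all0 => x1' x2' x3' [|[|[|[|e]]]] //; exact: supp.
Qed.

(* Here k stands for n - 2; at k = 0 the flag l is ignored.                   *)
Fixpoint fork_nonsingularb (k : nat) (l : bool) (F : {fset nat}) : bool :=
  match k with
  | 0 => (1 \notin F) && (2 \notin F)
  | k'.+1 =>
    if k'.+3 \notin F then fork_nonsingularb k' false F else
    match k' with
    | 0 => if l then ~~ ((1 \in F) && (2 \in F)) else (1 \in F) (+) (2 \in F)
    | k''.+1 => if l then fork_nonsingularb k' true F
                else (k'.+2 \in F) && fork_nonsingularb k'' false F
    end
  end.

Lemma fork_nonsingularP k l F : l ==> (0 < k) ->
  fork_nonsingular k.+2 l F <-> fork_nonsingularb k l F.
Proof.
elim/ltn_ind: k l => -[_ [] // _|k IHk l _]; first exact: fork_nonsingular2.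
rewrite /fork_nonsingularb -/fork_nonsingularb.
case: ifPn => [/fork_nonsingular_notin->|/negPn kF]; first exact: IHk.
case: k IHk kF => [|k] IHk kF; first exact: fork_nonsingular3.
case: l; first by rewrite fork_nonsingular_loop // IHk.
by rewrite fork_nonsingular_noloop // IHk //; split=> [[-> ->]|/andP].
Qed.

Lemma eq_fork_nonsingularb k l (F F' : {fset nat}) :
  (forall e, e <= k.+2 -> (e \in F) = (e \in F')) ->
  fork_nonsingularb k l F = fork_nonsingularb k l F'.
Proof.
elim/ltn_ind: k l => -[_ l|k IHk l] FF'; first by rewrite /= !FF'.
have sub j b : j <= k -> fork_nonsingularb j b F = fork_nonsingularb j b F'.
  by move=> jk; apply: IHk => // e ej; apply: FF'; lia.
rewrite /fork_nonsingularb -/fork_nonsingularb FF' // sub //.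
case: k {IHk} FF' sub => [|k] FF' sub; first by rewrite !FF'.
by rewrite FF' // !sub.
Qed.

(** * Counting the nonsingular vertex sets *)

Local Open Scope fset_scope.
Local Open Scope nat_scope.

Definition subset_count (P : pred {fset nat}) (n : nat) : nat :=
  #|` [fset F in fpowerset [fset e | e in iota 1 n] | P F]|.

Lemma subset_count0 P : subset_count P 0 = P fset0.
Proof.
rewrite /subset_count (_ : [fset e | e in iota 1 0] = fset0); last first.
  by apply/fsetP => e; rewrite !inE.
rewrite fpowerset0; case: (boolP (P fset0)) => P0.
  rewrite (_ : [fset _ in _ | _] = [fset fset0]) ?cardfs1 //.
  by apply/fsetP => F; rewrite !inE; case: eqP => // ->.
rewrite (_ : [fset _ in _ | _] = fset0) ?cardfs0 //.
by apply/fsetP => F; rewrite !inE; case: eqP => // ->; rewrite (negbTE P0).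
Qed.

Lemma eq_subset_count (P Q : pred {fset nat}) n :
  (forall F : {fset nat}, (forall e, e \in F -> 0 < e <= n) -> P F = Q F) ->
  subset_count P n = subset_count Q n.
Proof.
move=> PQ; congr #|` _|; apply/fsetP => F; rewrite !inE fpowersetE.
case: (boolP (F `<=` _)) => //= /fsubsetP sub; apply: PQ => e /sub.
by rewrite !inE mem_iota add1n ltnS.
Qed.

Lemma subset_countS P n :
  subset_count P n.+1
  = subset_count P n + subset_count (fun F => P (n.+1 |` F)) n.
Proof.
rewrite /subset_count; set A := [fset e | e in iota 1 n].
have An : n.+1 \notin A by rewrite !inE mem_iota; lia.
have -> : [fset e | e in iota 1 n.+1] = n.+1 |` A.
  by apply/fsetP => e; rewrite !inE !mem_iota; lia.
set B := [fset F in fpowerset A | P (n.+1 |` F)].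
(* The sets containing [n.+1] are counted as the image, under insertion of [n.+1], of subsets that
   avoid it. *)
have inj : {in B &, injective (fun F => n.+1 |` F)}.
  move=> F G; rewrite !inE !fpowersetE => /andP[FA _] /andP[GA _] eqFG.
  have nF : n.+1 \notin F by apply: contra An; apply: (fsubsetP FA).
  have nG : n.+1 \notin G by apply: contra An; apply: (fsubsetP GA).
  by rewrite -(fsetU1K nF) -(fsetU1K nG) eqFG.
rewrite -(card_in_imfset imfset_key inj) -cardfsUI.
set X := (X in _ = #|` X| + _); set Y := (Y in _ = _ + #|` Y|).
have -> : Y = fset0.
  apply/fsetP => F; rewrite !inE fpowersetE; apply/negP.
  case/andP=> /andP[FA _] /imfsetP[/= G _ F_eq]; case/negP: An.
  by apply: (fsubsetP FA); rewrite F_eq !inE eqxx.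
rewrite cardfs0 addn0; congr #|` _|; apply/fsetP => F; rewrite !inE !fpowersetE.
apply/andP/orP => [[FA PF]|[/andP[FA PF]|/imfsetP[/= G]]].
- case: (boolP (n.+1 \in F)) => nF; last first.
    left; rewrite PF andbT; apply/fsubsetP => e eF.
    have := fsubsetP FA _ eF; rewrite in_fset1U => /orP[/eqP e_eq|//].
    by rewrite e_eq (negbTE nF) in eF.
  right; apply/imfsetP; exists (F `\ n.+1); last by rewrite fsetD1K.
  by rewrite !inE fpowersetE fsetD1K // PF andbT fsubDset.
- by split=> //; apply: fsubset_trans FA _; apply: fsubsetUr.
by rewrite !inE fpowersetE => /andP[GA PG] ->; rewrite fsetUS.
Qed.

Lemma subset_count_notin k l :
  subset_count (fork_nonsingularb k.+1 l) k.+2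
  = subset_count (fork_nonsingularb k false) k.+2.
Proof.
apply: eq_subset_count => F sub.
rewrite /fork_nonsingularb -/fork_nonsingularb ifT //.
by apply/negP => /sub; rewrite ltnn andbF.
Qed.

Lemma fork_nonsingularb_fsetU1 k l e F : k.+2 < e ->
  fork_nonsingularb k l (e |` F) = fork_nonsingularb k l F.
Proof.
by move=> ke; apply: eq_fork_nonsingularb => i ik; rewrite !inE ltn_eqF //; lia.
Qed.

(** Sets avoiding the tip are counted by the fork one vertex shorter; sets containing it must
    contain its neighbour as well and are counted by the fork two vertices shorter. This is the
    Lucas recurrence. *)
Lemma subset_count_noloop k :
  subset_count (fork_nonsingularb k false) k.+2 = lucas k.+1.
Proof.
elim/ltn_ind: k => -[_|[_|k IHk]].
- by rewrite !subset_countS !subset_count0 /= !inE.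
- by rewrite !subset_countS !subset_count0 /= !inE.
rewrite -[lucas _]/(lucas k.+2 + lucas k.+1).
rewrite subset_countS subset_count_notin IHk //; congr (_ + _).
(* A second split, at the neighbour [k.+3] of the tip: sets without it contribute nothing. *)
rewrite subset_countS.
rewrite (@eq_subset_count _ xpred0) => [|F sub]; last first.
  rewrite /fork_nonsingularb -/fork_nonsingularb ifN ?negbK ?inE ?eqxx //.
  rewrite (_ : k.+3 \in F = false) ?orbF; last by apply/negP => /sub; lia.
  by rewrite ltn_eqF.
rewrite [X in X + _](_ : _ = 0) ?add0n; last first.
  by apply/eqP; rewrite cardfs_eq0; apply/eqP/fsetP => F; rewrite !inE andbF.
rewrite -IHk //.
apply: eq_subset_count => F _.
rewrite /fork_nonsingularb -/fork_nonsingularb ifN ?negbK ?inE ?eqxx ?orbT //.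
by rewrite !fork_nonsingularb_fsetU1.
Qed.

(** Sets avoiding the looped tip are counted by the shorter unlooped fork. For sets containing it,
    the pivot moves the loop one vertex down, giving the shorter looped fork. *)
Lemma subset_count_loop k :
  subset_count (fork_nonsingularb k.+1 true) k.+3 = lucas k.+3.
Proof.
elim: k => [|k IHk]; first by rewrite !subset_countS !subset_count0 /= !inE.
rewrite -[lucas _]/(lucas k.+3 + lucas k.+2).
rewrite subset_countS subset_count_notin subset_count_noloop addnC.
congr (_ + _); rewrite -IHk; apply: eq_subset_count => F _.
rewrite -(@fork_nonsingularb_fsetU1 k.+1 true k.+4 F) //.
have kF : k.+4 \in k.+4 |` F by rewrite !inE eqxx.
by rewrite /= kF.
Qed.

Theorem theorem5p4 (n : nat) (hn : 3 <= n) : kappa (Fprime n) = lucas n.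
Proof.
rewrite /kappa edges_Fprime // -/(subset_count _ n).
case: n hn => [|[|[|k]]] // hn; rewrite -subset_count_loop.
apply: eq_subset_count => F _; apply/idP/idP.
  by move/(quasi_tree_FprimeP _ hn)/fork_nonsingularP; apply.
by move=> h; apply/(quasi_tree_FprimeP _ hn)/fork_nonsingularP.
Qed.
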